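(* Let $Q$ be a finite (left) quasifield with $q$ elements and kernel $K$. Let $\gamma\in Q\setminus\{0\}$ and $A,B,C,D\subset Q$. If $N_\gamma(A,B,C,D)$ is the number of solutions to $a\cdot b + c\cdot d = \gamma$ with $(a,b,c,d)\in A\times B\times C\times D$, then \[ \left| N_\gamma(A,B,C,D) - \frac{|A||B||C||D|}{q}\right| \leq q\left(\frac{|A||B||C||D|}{|K|-1}\right)^{1/2}. \]
   Context: A (left) quasifield is a set $Q$ with two binary operations $+$ and $\cdot$ such that $(Q,+)$ is a group with identity $0$; $(Q\setminus\{0\},\cdot)$ is a loop (for all $a,b$ the equations $a\cdot x=b$ and $y\cdot a=b$ have unique solutions, and there is an identity $1$); $a\cdot(b+c)=a\cdot b+a\cdot c$ for all $a,b,c$; $0\cdot x=0$ for all $x$; and for $a\neq b$ the equation $a\cdot x=b\cdot x+c$ has exactly one solution $x$. The kernel $K$ of $Q$ is the set of all $k\in Q$ such that $(x+y)\cdot k = x\cdot k + y\cdot k$ and $(x\cdot y)\cdot k = x\cdot(y\cdot k)$ for all $x,y\in Q$. *)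

(* Defs.v *)
From mathcomp Require Import all_boot all_order all_algebra.

Set Implicit Arguments.
Unset Strict Implicit.
Unset Printing Implicit Defensive.

(* The additive group is written with bare operations, rather than as a
   zmodType, because commutativity of + is not one of the axioms. *)
Definition is_group (Q : Type) (add : Q -> Q -> Q) (zero : Q) : Prop :=
  [/\ associative add,
      left_id zero add,
      right_id zero add
    & forall x, exists y, add x y = zero /\ add y x = zero].

(* A loop structure on the subset P, for an operation defined on all of Q:
   P is closed under op, and solutions and identity are taken inside P. *)
Definition is_loop_on (Q : Type) (P : Q -> Prop) (op : Q -> Q -> Q) : Prop :=
  [/\ forall a b, P a -> P b -> P (op a b),
      forall a b, P a -> P b -> exists! x, P x /\ op a x = b,
      forall a b, P a -> P b -> exists! y, P y /\ op y a = b
    & exists e, P e /\ forall a, P a -> op e a = a /\ op a e = a].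

Definition is_quasifield (Q : Type) (add mul : Q -> Q -> Q) (zero : Q)
    : Prop :=
  [/\ is_group add zero,
      is_loop_on (fun x => x <> zero) mul,
      right_distributive mul add,
      left_zero zero mul
    & forall a b c, a <> b -> exists! x, mul a x = add (mul b x) c].

Definition kernel (Q : finType) (add mul : Q -> Q -> Q) : {set Q} :=
  [set k | [forall x, forall y,
     (mul (add x y) k == add (mul x k) (mul y k)) &&
     (mul (mul x y) k == mul x (mul y k))]].

Definition nb_solutions (Q : finType) (add mul : Q -> Q -> Q) (g : Q)
    (A B C D : {set Q}) : nat :=
  #|[set t : Q * Q * Q * Q | let: (a, b, c, d) := t in
      [&& a \in A, b \in B, c \in C, d \in D
        & add (mul a b) (mul c d) == g]]|.

(* Main.v *)
Require Import Defs.
From mathcomp Require Import all_boot all_order all_algebra.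
From mathcomp Require Import ring.
Import Order.TTheory GRing.Theory Num.Theory.
Local Open Scope ring_scope.

(** Write [e . p] for [a b + c d], where [e = (a, c)] and [p = (b, d)].  Two
    distinct vectors [e, e'] satisfy [e . p = e' . p] for exactly [q] of the
    [q ^ 2] vectors [p], so the values [e . p] are pairwise independent and a
    second moment computation over all [(p, z)] shows that any set [T] of pairs
    [(p, z)] has about [|S| |T| / q] incidences [e . p = z] with a set [S] of
    vectors, up to an error [q * sqrt (|S| |T|)].  The equation
    [e . p = g] is invariant under [(p, g) -> (p k, g k)] for [k] in the kernel,
    so taking [S = A x C] and [T = {(b k, d k, g k)}] with [k] nonzero in the
    kernel counts every solution [|K| - 1] times, which gains the factor
    [sqrt (|K| - 1)]. *)

(** * Second moment of incidence counts *)

Section SecondMoment.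

Set Implicit Arguments.
Unset Strict Implicit.

Variable R : rcfType.

Lemma sum_sqr_sub (I : finType) (T : {pred I}) (F : I -> R) (t : R) :
  \sum_(i in T) (F i - t) ^+ 2 =
  \sum_(i in T) F i ^+ 2 - 2 * t * \sum_(i in T) F i + #|T|%:R * t ^+ 2.
Proof.
rewrite mulr_sumr [#|T|%:R * _]mulr_natl -sumr_const -sumrB -big_split /=.
by apply: eq_bigr => i _; ring.
Qed.

(** Cauchy-Schwarz against the constant 1, read off from the nonnegativity of the variance about the
    mean. *)
Lemma sqr_sum_le_card (I : finType) (T : {pred I}) (F : I -> R) :
  (\sum_(i in T) F i) ^+ 2 <= #|T|%:R * \sum_(i in T) F i ^+ 2.
Proof.
have [T0|Tn0] := eqVneq #|T| 0%N.
  by rewrite big_pred0 ?expr0n ?T0 ?mul0r // => i; exact: card0_eq T0 i.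
have n_gt0 : 0 < #|T|%:R :> R by rewrite ltr0n lt0n.
have : 0 <= \sum_(i in T) (F i - (\sum_(j in T) F j) / #|T|%:R) ^+ 2.
  by apply: sumr_ge0 => i _; exact: sqr_ge0.
rewrite sum_sqr_sub -(pmulr_rge0 _ n_gt0) => var_ge0; rewrite -subr_ge0.
by move: var_ge0; congr (is_true (0 <= _)); field; rewrite gt_eqF.
Qed.

Variables (X Y Z : finType) (dot : X -> Y -> Z) (m : nat).
Hypothesis card_Y : #|Y| = (m * #|Z|)%N.
Hypothesis card_agree :
  forall e e', e != e' -> #|[set p | dot e p == dot e' p]| = m.

Definition incidences (S : {set X}) (y : Y * Z) : R :=
  \sum_(e in S) (dot e y.1 == y.2)%:R.

Lemma sum_eq_natr (T : finType) (a : T) (F : T -> R) :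
  \sum_z (a == z)%:R * F z = F a.
Proof.
rewrite (bigD1 a) //= eqxx mul1r big1 ?addr0 // => z /negPf.
by rewrite eq_sym => ->; rewrite mul0r.
Qed.

Lemma sum_incidences S : \sum_y incidences S y = #|S|%:R * #|Y|%:R.
Proof.
rewrite exchange_big /= mulr_natl -sumr_const; apply: eq_bigr => e _.
rewrite -(pair_bigA _ (fun p z => (dot e p == z)%:R)) /=.
rewrite -sum1_card natr_sum; apply: eq_bigr => p _.
rewrite -[RHS](sum_eq_natr (dot e p) (fun=> 1)).
by under [RHS]eq_bigr do rewrite mulr1.
Qed.

(** Expanding the square counts triples [(e, e', p)] with [dot e p = dot e' p]: a diagonal pair
    contributes [#|Y|], any other pair [m]. *)
Lemma sum_incidences_sqr S :
  \sum_y incidences S y ^+ 2 =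
  #|S|%:R * #|Y|%:R + #|S|%:R * (#|S|%:R - 1) * m%:R.
Proof.
have agree e e' : \sum_y (dot e y.1 == y.2)%:R * (dot e' y.1 == y.2)%:R
    = #|[set p | dot e p == dot e' p]|%:R :> R.
  rewrite -(pair_bigA _ (fun p z => (dot e p == z)%:R * (dot e' p == z)%:R)) /=.
  rewrite -sum1dep_card natr_sum [RHS]big_mkcond /=; apply: eq_bigr => p _.
  rewrite (sum_eq_natr _ (fun z => (dot e' p == z)%:R)) eq_sym.
  by case: eqP.
transitivity (\sum_(e in S) \sum_(e' in S)
    (#|[set p | dot e p == dot e' p]|%:R : R)).
  under eq_bigr do rewrite expr2 /incidences big_distrlr /=.
  rewrite exchange_big /=; apply: eq_bigr => e _.
  by rewrite exchange_big /=; apply: eq_bigr => e' _.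
transitivity (\sum_(e in S) (#|Y|%:R + (#|S|%:R - 1) * m%:R : R)); last first.
  by rewrite sumr_const -[_ *+ #|S|]mulr_natl; ring.
apply: eq_bigr => e eS; rewrite (bigD1 e) //=; congr (_ + _).
  by congr _%:R; rewrite -cardsT; apply: eq_card => p; rewrite !inE eqxx.
rewrite (eq_bigr (fun=> m%:R)) => [|e' /andP[_ ne]]; last first.
  by rewrite card_agree // eq_sym.
rewrite (eq_bigl (mem (S :\ e))) => [|e']; last by rewrite !inE andbC.
by rewrite sumr_const [#|S|](cardsD1 e) eS natrD addrC addKr mulr_natl.
Qed.

(** [#|S| / #|Z|] is the mean of [incidences S] over [Y * Z]. Since [#|Y| = m * #|Z|], the terms
    quadratic in [#|S|] cancel. *)
Lemma incidences_variance S :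
  \sum_y (incidences S y - #|S|%:R / #|Z|%:R) ^+ 2 <= #|S|%:R * #|Y|%:R.
Proof.
have [Z0|Zn0] := eqVneq #|Z| 0%N.
  rewrite big1 ?mulr_ge0 // => -[p z] _.
  by have := card0_eq Z0 z; rewrite inE.
have z_neq0 : #|Z|%:R != 0 :> R by rewrite pnatr_eq0.
set t := #|S|%:R / #|Z|%:R.
rewrite (sum_sqr_sub predT) sum_incidences_sqr sum_incidences card_prod.
rewrite natrM card_Y natrM /t -subr_ge0.
(* The exact value of the sum is [#|S| * #|Y| - #|S| * m]. *)
have -> : #|S|%:R * (m%:R * #|Z|%:R) -
  (#|S|%:R * (m%:R * #|Z|%:R) + #|S|%:R * (#|S|%:R - 1) * m%:R -
   2 * (#|S|%:R / #|Z|%:R) * (#|S|%:R * (m%:R * #|Z|%:R)) +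
   m%:R * #|Z|%:R * #|Z|%:R * (#|S|%:R / #|Z|%:R) ^+ 2)
  = #|S|%:R * m%:R :> R by field.
by rewrite mulr_ge0.
Qed.

Lemma incidence_bound (S : {set X}) (T : {set Y * Z}) :
  `| \sum_(y in T) incidences S y - #|S|%:R * #|T|%:R / #|Z|%:R |
  <= Num.sqrt (#|S|%:R * #|T|%:R * #|Y|%:R).
Proof.
have -> : \sum_(y in T) incidences S y - #|S|%:R * #|T|%:R / #|Z|%:R
    = \sum_(y in T) (incidences S y - #|S|%:R / #|Z|%:R).
  by rewrite sumrB sumr_const -[_ / _ *+ _]mulr_natr mulrAC.
rewrite -sqrtr_sqr ler_wsqrtr //.
apply: le_trans (sqr_sum_le_card _ _) _.
rewrite -mulrA [leRHS]mulrCA ler_wpM2l //.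
apply: le_trans (incidences_variance S).
(* The terms outside [T] are squares, so extending the sum to all pairs only enlarges it. *)
rewrite [leRHS](bigID (mem T)) /= lerDl.
by apply: sumr_ge0 => y _; exact: sqr_ge0.
Qed.

End SecondMoment.

(** * Quasifield arithmetic and agreement of dot products *)

Section Quasifield.

Set Implicit Arguments.
Unset Strict Implicit.

Variables (Q : finType) (add mul : Q -> Q -> Q) (zero : Q).
Hypothesis HQ : is_quasifield add mul zero.

Lemma qf_addIl a b c : add a b = add a c -> b = c.
Proof.
have [[addA add0 _ addV] _ _ _ _] := HQ.
have [a' [_ a'a]] := addV a.
by move/(congr1 (add a')); rewrite !addA a'a !add0.
Qed.

Lemma qf_addIr a b c : add b a = add c a -> b = c.
Proof.
have [[addA _ addr0 addV] _ _ _ _] := HQ.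
have [a' [aa' _]] := addV a.
by move/(congr1 (add^~ a')); rewrite -!addA aa' !addr0.
Qed.

Lemma qf_mulr0 a : mul a zero = zero.
Proof.
have [[_ add0 addr0 _] _ mulDr _ _] := HQ.
apply: (@qf_addIl (mul a zero)).
by rewrite -mulDr add0 addr0.
Qed.

Lemma qf_mul_neq0 a b : a <> zero -> b <> zero -> mul a b <> zero.
Proof. by have [_ [+ _ _ _] _ _ _] := HQ; apply. Qed.

Lemma qf_mulIl a b c : a <> zero -> b <> zero -> c <> zero ->
  mul a b = mul a c -> b = c.
Proof.
have [_ [mul_neq0 divl _ _] _ _ _] := HQ => a0 b0 c0 e.
have [x [_ ux]] := divl a (mul a c) a0 (mul_neq0 _ _ a0 c0).
by rewrite -(ux b) // -(ux c).
Qed.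

Lemma qf_mulIr k : k <> zero -> injective (mul^~ k).
Proof.
have [_ [mul_neq0 _ divr _] _ mul0 _] := HQ => k0 b c /= e.
have [b0|/eqP b0] := eqVneq b zero; have [c0|/eqP c0] := eqVneq c zero.
- by rewrite b0 c0.
- by case: (qf_mul_neq0 c0 k0); rewrite -e b0 mul0.
- by case: (qf_mul_neq0 b0 k0); rewrite e c0 mul0.
have [x [_ ux]] := divr k (mul c k) k0 (mul_neq0 _ _ c0 k0).
by rewrite -(ux b) // -(ux c).
Qed.

Definition dot (e p : Q * Q) : Q := add (mul e.1 p.1) (mul e.2 p.2).

(* Addition is not assumed commutative, so the axiom on [a x = b x + c] is
   applied to [- x] to reach this mirrored form. *)
Lemma qf_mirror_solution a b u v : a <> b ->
  exists! x, add u (mul a x) = add v (mul b x).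
Proof.
have [[addA add0 addr0 addV] _ mulDr _ solve] := HQ => ab.
have [v' [vv' v'v]] := addV v.
have mulN c x x' : add x x' = zero -> add (mul c x) (mul c x') = zero.
  by move=> xx'; rewrite -mulDr xx' qf_mulr0.
(* Cancelling [v] on the left and [a x] on the right preserves the order of the summands; [mulN]
   turns [- (a x)] and [- (b x)] into [a x'] and [b x']. *)
have equiv x x' : add x x' = zero -> add x' x = zero ->
    (add u (mul a x) = add v (mul b x)) <->
    (mul a x' = add (mul b x') (add v' u)).
  move=> xx' x'x; have [bx ax] := (mulN b _ _ x'x, mulN a _ _ xx').
  split=> e.
    apply: (@qf_addIl (mul b x)); rewrite addA (mulN b _ _ xx') add0.
    apply: (@qf_addIl v); rewrite !addA -e vv' add0 -addA ax addr0 //.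
  apply: (@qf_addIr (mul a x')); rewrite -addA ax addr0 e.
  by rewrite !addA -(addA v) (mulN b _ _ xx') addr0 vv' add0.
have [x' [ex' ux']] := solve a b (add v' u) ab.
have [x [x'x xx']] := addV x'.
exists x; split=> [|y ey]; first exact/(equiv x x').
have [y' [yy' y'y]] := addV y.
have x'y' : x' = y' by apply: ux'; apply/(equiv y y').
by apply: (@qf_addIl x'); rewrite x'x x'y' y'y.
Qed.

(** If the second coordinates differ, each [b] admits exactly one [d], so the agreement set is a
    graph over [Q]. If they coincide, [a b = a' b] forces [b = zero] and [d] is free. *)
Lemma card_dot_agree e e' : e != e' ->
  #|[set p | dot e p == dot e' p]| = #|Q|.
Proof.
case: e e' => [a c] [a' c'] ne.
have [cc'|/eqP cc'] := eqVneq c c'.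
  have aa' : a <> a' by move=> aa'; rewrite aa' cc' eqxx in ne.
  have [_ _ _ _ solve] := HQ; have [[_ _ addr0 _] _ _ _ _] := HQ.
  have [x [_ ux]] := solve a a' zero aa'.
  have x0 : x = zero by apply: ux; rewrite !qf_mulr0 addr0.
  rewrite -(card_imset predT (f := fun d => (zero, d))); last by move=> d d' [].
  apply: eq_card => -[b d]; rewrite inE /dot /= cc'; apply/eqP/imsetP.
    move/qf_addIr => ab; exists d => //.
    by rewrite -x0 (ux b) // addr0.
  by case=> d' _ [-> ->]; rewrite !qf_mulr0.
have sol b := qf_mirror_solution (mul a b) (mul a' b) cc'.
have solb b : exists x, add (mul a b) (mul c x) == add (mul a' b) (mul c' x).
  by have [x [/eqP ex _]] := sol b; exists x.
rewrite -(card_imset predT (f := fun b => (b, xchoose (solb b)))); last first.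
  by move=> b b' [].
apply: eq_card => -[b d]; rewrite inE /dot /=; apply/idP/imsetP.
  move=> /eqP e; exists b => //; congr pair.
  have [x [_ ux]] := sol b; rewrite -(ux d) //; apply: ux.
  exact/eqP/(xchooseP (solb b)).
by case=> b' _ [-> ->]; exact: xchooseP (solb b').
Qed.

Lemma dot_kernel e p k : k \in kernel add mul ->
  dot e (mul p.1 k, mul p.2 k) = mul (dot e p) k.
Proof.
rewrite inE => /forallP kK; rewrite /dot /=.
have mulD x y : mul (add x y) k = add (mul x k) (mul y k).
  by have /forallP/(_ y)/andP[/eqP] := kK x.
have mulA x y : mul (mul x y) k = mul x (mul y k).
  by have /forallP/(_ y)/andP[_ /eqP] := kK x.
by rewrite mulD !mulA.
Qed.

Lemma zero_kernel : zero \in kernel add mul.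
Proof.
have [[_ add0 _ _] _ _ _ _] := HQ.
by rewrite inE; apply/forallP => x; apply/forallP => y; rewrite !qf_mulr0 add0 !eqxx.
Qed.

(** The kernel contains [zero] and the loop identity, so the denominator [#|K| - 1] of the final
    bound is positive. *)
Lemma card_kernel_gt1 : (1 < #|kernel add mul|)%N.
Proof.
have [_ [_ _ _ [u [u0 uid]]] _ mul0 _] := HQ.
have mulu x : mul x u = x.
  by have [->|/eqP /uid[]//] := eqVneq x zero; rewrite mul0.
have uK : u \in kernel add mul.
  by rewrite inE; apply/forallP => x; apply/forallP => y; rewrite !mulu !eqxx.
rewrite (cardsD1 zero) zero_kernel (cardsD1 u) in_setD1 uK andbT.
by have /eqP -> := u0.
Qed.

End Quasifield.

(** * Amplification by kernel multiples *)

Theorem theorem1p13 (R : rcfType) (Q : finType) (add mul : Q -> Q -> Q)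
    (zero : Q) (HQ : is_quasifield add mul zero)
    (g : Q) (g_neq0 : g <> zero) (A B C D : {set Q}) :
  let q : R := #|Q|%:R in
  let K := kernel add mul in
  let P : R := #|A|%:R * #|B|%:R * #|C|%:R * #|D|%:R in
  `| (nb_solutions add mul g A B C D)%:R - P / q |
    <= q * Num.sqrt (P / (#|K|%:R - 1)).
Proof.
cbv zeta; set q : R := #|Q|%:R; set K := kernel add mul.
set P : R := #|A|%:R * #|B|%:R * #|C|%:R * #|D|%:R; set n : R := #|K|%:R - 1.
pose S := setX A C; pose K' := K :\ zero.
pose scale (t : Q * Q * Q) := ((mul t.1.1 t.2, mul t.1.2 t.2), mul g t.2).
pose T0 := setX (setX B D) K'; pose T := scale @: T0.
have K'P k : k \in K' -> k <> zero /\ k \in K.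
  by rewrite in_setD1 => /andP[/eqP].
(* As [g] is nonzero, the last coordinate [g k] determines [k], which then cancels on the right in
   the other two. *)
have scale_inj : {in T0 &, injective scale}.
  move=> [[b d] k] [[b' d'] k'] /setXP[_ /K'P[k0 _]] /setXP[_ /K'P[k'0 _]].
  case=> /= eb ed /(qf_mulIl HQ g_neq0 k0 k'0) ek.
  rewrite -ek in eb ed *.
  by rewrite (qf_mulIr HQ k0 eb) (qf_mulIr HQ k0 ed).
have nE : n = #|K'|%:R.
  by rewrite /n (cardsD1 zero) (zero_kernel HQ) natrD addrC addKr.
have n_gt0 : 0 < n by rewrite subr_gt0 ltr1n (card_kernel_gt1 HQ).
have cardT : #|T|%:R = #|B|%:R * #|D|%:R * n :> R.
  by rewrite card_in_imset // !cardsX !natrM nE.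
have cardS : #|S|%:R = #|A|%:R * #|C|%:R :> R by rewrite cardsX natrM.
have sumT : \sum_(y in T) incidences R (dot add mul) S y =
    n * (nb_solutions add mul g A B C D)%:R.
  have count1 t : t \in T0 -> incidences R (dot add mul) S (scale t) =
      \sum_(e in S) (dot add mul e t.1 == g)%:R.
    case: t => p k /setXP[_ /K'P[k0 kK]]; apply: eq_bigr => e _ /=.
    rewrite dot_kernel //; congr (nat_of_bool _)%:R.
    exact/(inj_eq (qf_mulIr HQ k0)).
  rewrite big_imset //= (eq_bigr _ count1).
  rewrite (eq_bigl (fun t => (t.1 \in setX B D) && (t.2 \in K'))); last first.
    by case=> p k; rewrite in_setX.
  rewrite -(pair_big (mem (setX B D)) (mem K')
    (fun p _ => \sum_(e in S) (dot add mul e p == g)%:R)) /=.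
  under eq_bigr do rewrite sumr_const -[_ *+ #|K'|]mulr_natl -nE.
  rewrite -mulr_sumr; congr (_ * _).
  rewrite exchange_big pair_big /= -natr_sum -big_mkcondr sum1_card.
  congr _%:R.
  (* The incidence sum groups the variables as vector and point, the solution count as
     [(a, b, c, d)]. *)
  pose swap (t : Q * Q * Q * Q) := let: (a, b, c, d) := t in ((a, c), (b, d)).
  have swap_bij : bijective swap.
    by exists (fun u => (u.1.1, u.2.1, u.1.2, u.2.2)) => [[[[]]]|[[? ?] []]].
  rewrite /nb_solutions -!sum1_card (reindex swap) /=; last exact: onW_bij.
  apply: eq_bigl => -[[[a b] c] d]; rewrite inE unfold_in /dot /= !in_setX.
  by case: (a \in A); case: (b \in B); case: (c \in C); case: (d \in D).
have := incidence_bound R (card_prod _ _) (card_dot_agree HQ) S T.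
rewrite sumT cardS cardT card_prod natrM -/q => bound.
rewrite -(ler_pM2l n_gt0) -{1}(gtr0_norm n_gt0) -normrM.
(* Both sides equal [q * sqrt (P n)]; the factor [q * q] is the number of points [(b, d)]. *)
have -> : n * (q * Num.sqrt (P / n)) =
    Num.sqrt (#|A|%:R * #|C|%:R * (#|B|%:R * #|D|%:R * n) * (q * q)).
  rewrite -{1}(gtr0_norm n_gt0) -{1}[q]ger0_norm // -!sqrtr_sqr.
  rewrite -!sqrtrM ?sqr_ge0 //; congr Num.sqrt; rewrite /P; field.
  by rewrite gt_eqF.
by congr (is_true (`|_| <= _)): bound; rewrite /P; ring.
Qed.
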